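(* Reflection principles (considered up to $\simeq$) form a linear ordering $$u{:}P\rightarrow P\ \prec\ \Box u{:}P\rightarrow P\ \prec\ \Box^2u{:}P\rightarrow P\ \prec\ \ldots\ \prec\ \Box P\rightarrow P .$$ Explicitly: every generator is equivalent ($\simeq$) to one of the generators in this chain, and for every integer $k\ge 0$, $$\bigl(\Box^k u{:}P\rightarrow P\bigr)\ \prec\ \bigl(\Box^{k+1}u{:}P\rightarrow P\bigr)\qquad\text{and}\qquad \bigl(\Box^k u{:}P\rightarrow P\bigr)\ \prec\ \bigl(\Box P\rightarrow P\bigr).$$
   Context: $\mathsf{PA}$ is Peano Arithmetic. A proof predicate is a provably decidable (i.e. $\mathsf{PA}$-provably $\Delta_1$) arithmetical formula $\mathrm{Proof}(x,y)$ that enumerates all theorems of $\mathsf{PA}$: $\mathsf{PA}\vdash\varphi$ iff $\mathrm{Proof}(k,\varphi)$ holds for some natural number $k$ (formulas are identified with their codes). It is normal if (1) for every $k$ the set $T(k)=\{\varphi\mid \mathrm{Proof}(k,\varphi)\}$ is finite and the function $k\mapsto T(k)$ is computable; (2) for any $k,l$ there is $n$ with $T(k)\cup T(l)\subseteq T(n)$. (Prime example: Gödel's proof predicate.) Fix a normal proof predicate $\mathrm{Proof}$ and let $\mathrm{Provable}(F)$ be $\exists x\,\mathrm{Proof}(x,F)$. It is assumed that $\mathrm{Provable}$ obeys the axioms of provability logic: for all arithmetical sentences $F,G$, writing $\Box$ for $\mathrm{Provable}$, $\mathsf{PA}$ proves $\Box(F\rightarrow G)\rightarrow(\Box F\rightarrow\Box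 G)$, $\Box F\rightarrow\Box\Box F$ and $\Box(\Box F\rightarrow F)\rightarrow\Box F$. Formulas here are built from propositional (sentence) letters by Boolean connectives, $\Box F$ (''$F$ is provable'') and $u{:}F$ (''$u$ is a proof of $F$''), with $u$ a proof variable. An arithmetical interpretation $\ast$ assigns an arithmetical sentence to each propositional letter and a natural number to each proof variable; it commutes with Boolean connectives, and $(\Box F)^\ast=\mathrm{Provable}(F^\ast)$, $(u{:}F)^\ast=\mathrm{Proof}(u^\ast,F^\ast)$. For a formula $F$, $\{F^\ast\}$ is the set of all its arithmetical interpretations. Let $P$ be a propositional letter and let each $Q_1,\ldots,Q_m$ ($m\ge1$) be either $\Box$ or ''$u{:}$'' for some fresh proof variable $u$ (so distinct occurrences use distinct proof variables). The formula $Q_1Q_2\ldots Q_mP\rightarrow P$ is called a generator, and the set of all its arithmetical interpretations is the corresponding reflection principle; reflection principles are referred to by their generators. $\Box^k$ denotes $k$ consecutive $\Box$'s. For formulas $G,H$: $H\preceq G$ means that $\mathsf{PA}+\{G^\ast\}$ proves all formulas in $\{H^\ast\}$; $H\simeq G$ means $H\preceq G$ and $G\preceq H$; $H\prec G$ means $H\preceq G$ and not $H\simeq G$. *)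

(* Defs.v *)
From Stdlib Require Import Arith List Cantor.
Import ListNotations.

(** Variables are de Bruijn indices. *)
Inductive term : Type :=
| Var (i : nat)
| Zero
| Succ (t : term)
| Add (s t : term)
| Mul (s t : term).

(** [{Bot, Imp, All}] is a complete basis for classical logic; the other
    connectives are the usual abbreviations. *)
Inductive form : Type :=
| Bot
| Eq (s t : term)
| Imp (A B : form)
| All (A : form).

Definition Not (A : form) : form := Imp A Bot.
Definition And (A B : form) : form := Not (Imp A (Not B)).
Definition Iff (A B : form) : form := And (Imp A B) (Imp B A).
Definition Ex (A : form) : form := Not (All (Not A)).

Definition scons {X : Type} (x : X) (s : nat -> X) (i : nat) : X :=
  match i with 0 => x | S j => s j end.

Fixpoint tsubst (s : nat -> term) (t : term) : term :=
  match t with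
  | Var i => s i
  | Zero => Zero
  | Succ t1 => Succ (tsubst s t1)
  | Add t1 t2 => Add (tsubst s t1) (tsubst s t2)
  | Mul t1 t2 => Mul (tsubst s t1) (tsubst s t2)
  end.

Definition tshift (t : term) : term := tsubst (fun i => Var (S i)) t.

Definition up (s : nat -> term) : nat -> term :=
  scons (Var 0) (fun i => tshift (s i)).

Fixpoint subst (s : nat -> term) (A : form) : form :=
  match A with
  | Bot => Bot
  | Eq t1 t2 => Eq (tsubst s t1) (tsubst s t2)
  | Imp B C => Imp (subst s B) (subst s C)
  | All B => All (subst (up s) B)
  end.

Definition shift (A : form) : form := subst (fun i => Var (S i)) A.

Definition inst (A : form) (t : term) : form := subst (scons t Var) A.

Fixpoint numeral (n : nat) : term :=
  match n with 0 => Zero | S m => Succ (numeral m) end.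

Fixpoint tclosed (n : nat) (t : term) : Prop :=
  match t with
  | Var i => i < n
  | Zero => True
  | Succ t1 => tclosed n t1
  | Add t1 t2 | Mul t1 t2 => tclosed n t1 /\ tclosed n t2
  end.

(** All free variables of [A] have index below [n]. *)
Fixpoint closed (n : nat) (A : form) : Prop :=
  match A with
  | Bot => True
  | Eq t1 t2 => tclosed n t1 /\ tclosed n t2
  | Imp B C => closed n B /\ closed n C
  | All B => closed (S n) B
  end.

Definition sentence (A : form) : Prop := closed 0 A.

Fixpoint teval (e : nat -> nat) (t : term) : nat :=
  match t with
  | Var i => e i
  | Zero => 0
  | Succ t1 => S (teval e t1)
  | Add t1 t2 => teval e t1 + teval e t2
  | Mul t1 t2 => teval e t1 * teval e t2
  end.

Fixpoint sat (e : nat -> nat) (A : form) : Prop :=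
  match A with
  | Bot => False
  | Eq t1 t2 => teval e t1 = teval e t2
  | Imp B C => sat e B -> sat e C
  | All B => forall n, sat (scons n e) B
  end.

Definition holds (A : form) : Prop := forall e, sat e A.

(** Classical natural deduction with equality: a [theory] is a set of axioms
    and the list a finite context of open assumptions.  The rule [d_gen] shifts
    the context but not the axioms, so free variables of axioms are read as
    universally quantified. *)
Definition theory : Type := form -> Prop.

Inductive derives (T : theory) : list form -> form -> Prop :=
| d_ax G A : T A -> derives T G A
| d_hyp G A : In A G -> derives T G A
| d_imp_intro G A B : derives T (A :: G) B -> derives T G (Imp A B)
| d_imp_elim G A B : derives T G (Imp A B) -> derives T G A -> derives T G B
| d_raa G A : derives T (Not A :: G) Bot -> derives T G A
| d_gen G A : derives T (map shift G) A -> derives T G (All A)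
| d_inst G A t : derives T G (All A) -> derives T G (inst A t)
| d_refl G t : derives T G (Eq t t)
| d_leibniz G A s t :
    derives T G (Eq s t) -> derives T G (inst A s) -> derives T G (inst A t).

Definition proves (T : theory) (A : form) : Prop := derives T [] A.

Inductive PA : theory :=
| pa_succ_nonzero : PA (All (Not (Eq (Succ (Var 0)) Zero)))
| pa_succ_inj :
    PA (All (All (Imp (Eq (Succ (Var 1)) (Succ (Var 0))) (Eq (Var 1) (Var 0)))))
| pa_add_zero : PA (All (Eq (Add (Var 0) Zero) (Var 0)))
| pa_add_succ :
    PA (All (All (Eq (Add (Var 1) (Succ (Var 0))) (Succ (Add (Var 1) (Var 0))))))
| pa_mul_zero : PA (All (Eq (Mul (Var 0) Zero) Zero))
| pa_mul_succ :
    PA (All (All (Eq (Mul (Var 1) (Succ (Var 0)))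
                     (Add (Mul (Var 1) (Var 0)) (Var 1)))))
| pa_induction (A : form) :
    PA (Imp (inst A Zero)
         (Imp (All (Imp A (subst (scons (Succ (Var 0)) (fun i => Var (S i))) A)))
           (All A))).

Definition Le (s t : term) : form := Ex (Eq (Add (Var 0) (tshift s)) (tshift t)).

Inductive Delta0 : form -> Prop :=
| delta0_bot : Delta0 Bot
| delta0_eq s t : Delta0 (Eq s t)
| delta0_imp A B : Delta0 A -> Delta0 B -> Delta0 (Imp A B)
| delta0_ball t A : Delta0 A -> Delta0 (All (Imp (Le (Var 0) (tshift t)) A)).

Inductive Sigma1 : form -> Prop :=
| sigma1_delta0 A : Delta0 A -> Sigma1 A
| sigma1_ex A : Sigma1 A -> Sigma1 (Ex A).

Inductive Pi1 : form -> Prop :=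
| pi1_delta0 A : Delta0 A -> Pi1 A
| pi1_all A : Pi1 A -> Pi1 (All A).

Definition PA_Delta1 (A : form) : Prop :=
  (exists B, Sigma1 B /\ proves PA (Iff A B)) /\
  (exists B, Pi1 B /\ proves PA (Iff A B)).

Definition pair_code (a b : nat) : nat := Cantor.to_nat (a, b).

Fixpoint tcode (t : term) : nat :=
  match t with
  | Var i => pair_code 0 i
  | Zero => pair_code 1 0
  | Succ t1 => pair_code 2 (tcode t1)
  | Add t1 t2 => pair_code 3 (pair_code (tcode t1) (tcode t2))
  | Mul t1 t2 => pair_code 4 (pair_code (tcode t1) (tcode t2))
  end.

Fixpoint code (A : form) : nat :=
  match A with
  | Bot => pair_code 0 0
  | Eq t1 t2 => pair_code 1 (pair_code (tcode t1) (tcode t2))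
  | Imp B C => pair_code 2 (pair_code (code B) (code C))
  | All B => pair_code 3 (code B)
  end.

Lemma pair_code_inj a b c d : pair_code a b = pair_code c d -> a = c /\ b = d.
Proof. unfold pair_code; intros H; apply Cantor.to_nat_inj in H; now injection H. Qed.

Lemma tcode_inj s t : tcode s = tcode t -> s = t.
Proof.
  revert t; induction s; intros []; cbn -[pair_code]; intros H;
    apply pair_code_inj in H as [H1 H2]; try discriminate; auto;
    try (apply pair_code_inj in H2 as [H2 H3]); f_equal; auto.
Qed.

Lemma code_inj A B : code A = code B -> A = B.
Proof.
  revert B; induction A; intros []; cbn -[pair_code]; intros H;
    apply pair_code_inj in H as [H1 H2]; try discriminate; auto;
    try (apply pair_code_inj in H2 as [H2 H3]); f_equal; auto using tcode_inj.
Qed.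

(** Programs for partial recursive functions; [reval e v y] says that [e]
    converges on the arguments [v] with value [y]. *)
Inductive recfun : Type :=
| RZero
| RSucc
| RProj (i : nat)
| RComp (f : recfun) (gs : list recfun)
| RPrim (f g : recfun)
| RMin (f : recfun).

Inductive reval : recfun -> list nat -> nat -> Prop :=
| reval_zero v : reval RZero v 0
| reval_succ x v : reval RSucc (x :: v) (S x)
| reval_proj i v x : nth_error v i = Some x -> reval (RProj i) v x
| reval_comp f gs v ws y :
    Forall2 (fun g w => reval g v w) gs ws -> reval f ws y ->
    reval (RComp f gs) v y
| reval_prim_zero f g v y : reval f v y -> reval (RPrim f g) (0 :: v) y
| reval_prim_succ f g n v z y :
    reval (RPrim f g) (n :: v) z -> reval g (n :: z :: v) y ->
    reval (RPrim f g) (S n :: v) y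
| reval_min f v n :
    reval f (n :: v) 0 ->
    (forall k, k < n -> exists z, reval f (k :: v) (S z)) ->
    reval (RMin f) v n.

Definition computable (f : nat -> nat) : Prop :=
  exists e, forall x, reval e [x] (f x).

(** A formula [prf] with free variables among [Var 0] (the proof) and [Var 1]
    (the code of the formula proved) represents Proof(x,y). *)
Definition Prf (prf : form) (k : nat) (A : form) : form :=
  subst (scons (numeral k) (scons (numeral (code A)) Var)) prf.

Definition Provable (prf : form) (A : form) : form :=
  Ex (subst (scons (Var 0) (scons (numeral (code A)) (fun i => Var (S i)))) prf).

Definition proof_predicate (prf : form) : Prop :=
  closed 2 prf /\
  PA_Delta1 prf /\
  (forall A, proves PA A <-> exists k, holds (Prf prf k A)).

Definition proved_by (prf : form) (k : nat) (A : form) : Prop :=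
  holds (Prf prf k A).

(** A finite set of formulas is presented to a program by its canonical index,
    the number whose binary digits equal to 1 sit at the codes of its elements;
    having such an index entails being finite. *)
Definition canonical_index (n : nat) (X : form -> Prop) : Prop :=
  forall y, Nat.testbit n y = true <-> exists A, y = code A /\ X A.

Definition normal_proof_predicate (prf : form) : Prop :=
  proof_predicate prf /\
  (exists f, computable f /\ forall k, canonical_index (f k) (proved_by prf k)) /\
  (forall k l, exists n, forall A,
     proved_by prf k A \/ proved_by prf l A -> proved_by prf n A).

Definition obeys_provability_logic (prf : form) : Prop :=
  let Box := Provable prf in
  forall F G, sentence F -> sentence G ->
    proves PA (Imp (Box (Imp F G)) (Imp (Box F) (Box G))) /\
    proves PA (Imp (Box F) (Box (Box F))) /\
    proves PA (Imp (Box (Imp (Box F) F)) (Box F)).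

(** As for [form], the remaining Boolean connectives are abbreviations. *)
Inductive pform : Type :=
| Letter (p : nat)
| PBot
| PImp (F G : pform)
| PBox (F : pform)
| PProof (u : nat) (F : pform).

Record interpretation : Type := {
  letter_val : nat -> form;
  letter_sentence : forall p, sentence (letter_val p);
  proofvar_val : nat -> nat
}.

Fixpoint interp (prf : form) (I : interpretation) (F : pform) : form :=
  match F with
  | Letter p => letter_val I p
  | PBot => Bot
  | PImp F1 F2 => Imp (interp prf I F1) (interp prf I F2)
  | PBox F1 => Provable prf (interp prf I F1)
  | PProof u F1 => Prf prf (proofvar_val I u) (interp prf I F1)
  end.

Definition interps (prf : form) (F : pform) : theory :=
  fun A => exists I, A = interp prf I F.

Definition PA_plus (T : theory) : theory := fun A => PA A \/ T A.

Definition preceq (prf : form) (H G : pform) : Prop :=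
  forall A, interps prf H A -> proves (PA_plus (interps prf G)) A.

Definition simeq (prf : form) (G H : pform) : Prop :=
  preceq prf H G /\ preceq prf G H.

Definition prec (prf : form) (H G : pform) : Prop :=
  preceq prf H G /\ ~ simeq prf H G.

Inductive modality : Type :=
| MBox
| MProof (u : nat).

Definition apply_modality (Q : modality) (F : pform) : pform :=
  match Q with MBox => PBox F | MProof u => PProof u F end.

(** [reflection [Q1; ...; Qm] P] is [Q1 ... Qm P -> P]. *)
Definition reflection (Qs : list modality) (P : nat) : pform :=
  PImp (fold_right apply_modality (Letter P) Qs) (Letter P).

Definition proof_vars (Qs : list modality) : list nat :=
  flat_map (fun Q => match Q with MBox => [] | MProof u => [u] end) Qs.

Definition generator (G : pform) : Prop :=
  exists Qs P, Qs <> [] /\ NoDup (proof_vars Qs) /\ G = reflection Qs P.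

(** [Box^k u:P -> P] *)
Definition chain (k u P : nat) : pform :=
  reflection (repeat MBox k ++ [MProof u]) P.

(** [Box P -> P] *)
Definition chain_top (P : nat) : pform := reflection [MBox] P.

(* Main.v *)
(** If [Q1 ... Qm] begins with [k] boxes followed by "u:", an instance
    [Box^k Prf n F -> phi] is provable outright when [Prf n F] is true (then [phi]
    is provable, by soundness of PA) and amounts to [Box^k Bot -> phi] when it is
    false (then PA refutes [Prf n F]).  Hence the principle is equivalent to
    [Con k := ~ Box^k Bot], and strictness comes from Löb's theorem.  If all
    [Qi] are boxes, the principle is equivalent to [Box P -> P], which yields
    every [Con k]. *)
From Stdlib Require Import Arith List Lia Classical.
Require Import Defs.
Import ListNotations.

(** * Substitution calculus for de Bruijn terms and formulas *)

Lemma tsubst_ext s s' t : (forall i, s i = s' i) -> tsubst s t = tsubst s' t.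
Proof. intros H; induction t; simpl; congruence. Qed.

Lemma up_ext s s' : (forall i, s i = s' i) -> forall i, up s i = up s' i.
Proof. intros H [|i]; unfold up; simpl; congruence. Qed.

(** Substitutions are functions; comparing them pointwise avoids functional extensionality. *)
Lemma subst_ext A : forall s s', (forall i, s i = s' i) -> subst s A = subst s' A.
Proof.
  induction A; intros s1 s2 H; simpl; f_equal; auto using tsubst_ext, up_ext.
Qed.

Lemma tsubst_comp s s' t :
  tsubst s (tsubst s' t) = tsubst (fun i => tsubst s (s' i)) t.
Proof. induction t; simpl; congruence. Qed.

Lemma tsubst_up_tshift s t : tsubst (up s) (tshift t) = tshift (tsubst s t).
Proof. unfold tshift; rewrite !tsubst_comp; apply tsubst_ext; reflexivity. Qed.

Lemma up_comp s s' i :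
  tsubst (up s) (up s' i) = up (fun j => tsubst s (s' j)) i.
Proof. destruct i; [reflexivity|apply tsubst_up_tshift]. Qed.

Lemma subst_comp A : forall s s',
  subst s (subst s' A) = subst (fun i => tsubst s (s' i)) A.
Proof.
  induction A; intros s1 s2; simpl; f_equal; auto using tsubst_comp.
  rewrite IHA; apply subst_ext; intros; apply up_comp.
Qed.

Lemma tsubst_Var t : tsubst Var t = t.
Proof. induction t; simpl; congruence. Qed.

Lemma subst_id A : forall s, (forall i, s i = Var i) -> subst s A = A.
Proof.
  assert (E : forall s t, (forall i, s i = Var i) -> tsubst s t = t)
    by (intros; rewrite <- (tsubst_Var t) at 2; now apply tsubst_ext).
  induction A; intros s' H; simpl; f_equal; auto.
  apply IHA; intros [|i]; [reflexivity|]; unfold up; simpl; now rewrite H.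
Qed.

Lemma tsubst_scons_tshift t s u : tsubst (scons u s) (tshift t) = tsubst s t.
Proof. unfold tshift; rewrite tsubst_comp; now apply tsubst_ext. Qed.

Lemma tsubst_inst_tshift t u : tsubst (scons u Var) (tshift t) = t.
Proof. rewrite tsubst_scons_tshift; apply tsubst_Var. Qed.

Lemma subst_inst s A t : subst s (inst A t) = inst (subst (up s) A) (tsubst s t).
Proof.
  unfold inst; rewrite !subst_comp; apply subst_ext; intros [|i]; [reflexivity|].
  cbn; now rewrite tsubst_inst_tshift.
Qed.

Lemma subst_up_shift s A : subst (up s) (shift A) = shift (subst s A).
Proof. unfold shift; rewrite !subst_comp; apply subst_ext; reflexivity. Qed.

Lemma subst_Le s a b : subst s (Le a b) = Le (tsubst s a) (tsubst s b).
Proof. unfold Le, Ex, Not; simpl; now rewrite !tsubst_up_tshift. Qed.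

Lemma tsubst_numeral s n : tsubst s (numeral n) = numeral n.
Proof. induction n; simpl; congruence. Qed.

Lemma tclosed_tsubst n m s t :
  tclosed n t -> (forall i, i < n -> tclosed m (s i)) -> tclosed m (tsubst s t).
Proof. intros Ht Hs; induction t; simpl in *; intuition. Qed.

Lemma tclosed_tshift n t : tclosed n t -> tclosed (S n) (tshift t).
Proof. intros H; apply (tclosed_tsubst n); simpl; auto with arith. Qed.

Lemma tclosed_up n m s :
  (forall i, i < n -> tclosed m (s i)) ->
  forall i, i < S n -> tclosed (S m) (up s i).
Proof.
  intros H [|i] Hi; simpl; [lia|]. apply tclosed_tshift, H; lia.
Qed.

Lemma closed_subst A : forall n m s,
  closed n A -> (forall i, i < n -> tclosed m (s i)) -> closed m (subst s A).
Proof.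
  induction A; intros n m s' HA Hs; simpl in *; intuition eauto using tclosed_tsubst.
  eapply IHA; [eassumption|]; now apply tclosed_up.
Qed.

Lemma tsubst_closed n s s' t :
  tclosed n t -> (forall i, i < n -> s i = s' i) -> tsubst s t = tsubst s' t.
Proof. intros Ht Hs; induction t; simpl in *; f_equal; intuition. Qed.

(** Allows the irrelevant tail of a substitution to be replaced by any default, as in [Prf_num]. *)
Lemma subst_closed A : forall n s s',
  closed n A -> (forall i, i < n -> s i = s' i) -> subst s A = subst s' A.
Proof.
  induction A; intros n s1 s2 HA Hs; simpl in *; f_equal; intuition eauto using tsubst_closed.
  eapply IHA; [eassumption|]. intros [|i] Hi; [reflexivity|].
  unfold up; simpl; rewrite Hs; [reflexivity|lia].
Qed.

Lemma subst_sentence s A : sentence A -> subst s A = A.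
Proof.
  intros H; rewrite <- (subst_id A Var) at 2 by reflexivity.
  apply (subst_closed A 0); [exact H|lia].
Qed.

Lemma tclosed_numeral m n : tclosed m (numeral n).
Proof. induction n; simpl; auto. Qed.

(** * Truth in the standard model and soundness *)

Lemma teval_ext e e' t : (forall i, e i = e' i) -> teval e t = teval e' t.
Proof. intros H; induction t; simpl; congruence. Qed.

Lemma scons_ext (e e' : nat -> nat) n :
  (forall i, e i = e' i) -> forall i, scons n e i = scons n e' i.
Proof. intros H [|i]; simpl; auto. Qed.

Lemma sat_ext A : forall e e', (forall i, e i = e' i) -> sat e A <-> sat e' A.
Proof.
  induction A; intros e e' H; simpl.
  - tauto.
  - now rewrite (teval_ext e e' s H), (teval_ext e e' t H).
  - now rewrite (IHA1 e e' H), (IHA2 e e' H).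
  - split; intros K n; eapply IHA; try apply K; intros; apply scons_ext; auto.
Qed.

Lemma teval_tsubst e s t : teval e (tsubst s t) = teval (fun i => teval e (s i)) t.
Proof. induction t; simpl; congruence. Qed.

Lemma teval_tshift n e t : teval (scons n e) (tshift t) = teval e t.
Proof. unfold tshift; rewrite teval_tsubst; now apply teval_ext. Qed.

Lemma sat_subst A : forall e s, sat e (subst s A) <-> sat (fun i => teval e (s i)) A.
Proof.
  induction A; intros e s'; simpl.
  - tauto.
  - now rewrite !teval_tsubst.
  - now rewrite IHA1, IHA2.
  - assert (E : forall n, sat (scons n e) (subst (up s') A) <->
                          sat (scons n (fun i => teval e (s' i))) A).
    { intros n; rewrite IHA; apply sat_ext; intros [|i]; [reflexivity|].
      apply teval_tshift. }
    split; intros K n; apply E, K.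
Qed.

Lemma sat_inst e A t : sat e (inst A t) <-> sat (scons (teval e t) e) A.
Proof. unfold inst; rewrite sat_subst; apply sat_ext; now intros [|i]. Qed.

Lemma sat_shift n e A : sat (scons n e) (shift A) <-> sat e A.
Proof. unfold shift; rewrite sat_subst; now apply sat_ext. Qed.

Lemma sat_Iff e A B : sat e (Iff A B) <-> (sat e A <-> sat e B).
Proof. simpl; destruct (classic (sat e A)), (classic (sat e B)); tauto. Qed.

Lemma sat_Ex e A : sat e (Ex A) <-> exists n, sat (scons n e) A.
Proof.
  simpl; split.
  - intros H; apply NNPP; intros K; apply H; intros n Hn; eauto.
  - intros [n Hn] H; exact (H n Hn).
Qed.

Lemma sat_Le e s t : sat e (Le s t) <-> teval e s <= teval e t.
Proof.
  unfold Le; rewrite sat_Ex; cbn; split.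
  - intros [n Hn]; rewrite !teval_tshift in Hn; lia.
  - intros H; exists (teval e t - teval e s); rewrite !teval_tshift; lia.
Qed.

Lemma teval_numeral e n : teval e (numeral n) = n.
Proof. induction n; simpl; congruence. Qed.

(** The rule [d_gen] changes the environment but leaves the axioms unshifted, so the axioms have to
    be true in every environment. *)
Lemma soundness T G A :
  (forall B, T B -> holds B) -> derives T G A ->
  forall e, (forall B, In B G -> sat e B) -> sat e A.
Proof.
  intros HT H; induction H; intros e HG.
  - now apply HT.
  - now apply HG.
  - intros HA; apply IHderives; intros C [<-|HC]; auto.
  - now apply IHderives1, IHderives2.
  - apply NNPP; intros HA; apply (IHderives e); intros C [<-|HC]; auto.
  - intros n; apply IHderives; intros B HB.
    apply in_map_iff in HB as (C & <- & HC); apply sat_shift; auto.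
  - apply sat_inst, IHderives, HG.
  - reflexivity.
  - specialize (IHderives1 e HG); specialize (IHderives2 e HG); simpl in IHderives1.
    rewrite sat_inst in *; now rewrite <- IHderives1.
Qed.

Lemma PA_holds A : PA A -> holds A.
Proof.
  intros [] e; cbn; try (intros; lia).
  (* Only the induction scheme is left; it becomes induction on [n] in the standard model. *)
  rewrite sat_inst; intros H0 HS n; induction n as [|n IH]; [exact H0|].
  specialize (HS n IH); rewrite sat_subst in HS.
  revert HS; apply sat_ext; now intros [|i].
Qed.

Lemma PA_sound A : proves PA A -> holds A.
Proof.
  intros H e; apply (soundness PA [] A PA_holds H); intros B [].
Qed.

(** * Admissible structural rules and closure under substitution *)

Lemma weakening T G A : derives T G A -> forall G', incl G G' -> derives T G' A.
Proof.
  intros H; induction H; intros G' HG;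
    eauto using derives, incl_map, incl_cons, incl_tl, in_eq.
Qed.

Lemma weaken_closed T G A : proves T A -> derives T G A.
Proof. intros H; apply (weakening T [] A H), incl_nil_l. Qed.

Lemma weaken_cons T G A B : derives T G A -> derives T (B :: G) A.
Proof. intros H; apply (weakening T G A H), incl_tl, incl_refl. Qed.

(** The new proofs of axioms have an empty context, so weakening alone transplants them, even below
    [d_gen]. *)
Lemma derives_cut (T T' : theory) G A :
  (forall B, T B -> proves T' B) -> derives T G A -> derives T' G A.
Proof. intros HT H; induction H; eauto using derives, weaken_closed. Qed.

(** The basic axioms are closed. A substituted induction axiom is the one for [subst (up s) A],
    because substitution under the binder commutes with replacing the bound variable by its
    successor. *)
Lemma PA_subst s A : PA A -> PA (subst s A).
Proof.
  intros []; try constructor.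
  cbn [subst]; rewrite subst_inst.
  replace (subst (up s) (subst (scons (Succ (Var 0)) (fun i => Var (S i))) A0))
    with (subst (scons (Succ (Var 0)) (fun i => Var (S i))) (subst (up s) A0)).
  { constructor. }
  rewrite !subst_comp; apply subst_ext; intros [|i]; [reflexivity|].
  cbn; now rewrite tsubst_scons_tshift.
Qed.

Lemma derives_subst G A : derives PA G A ->
  forall s, derives PA (map (subst s) G) (subst s A).
Proof.
  intros H; induction H; intros s'.
  - now apply d_ax, PA_subst.
  - now apply d_hyp, in_map.
  - apply d_imp_intro, IHderives.
  - eapply d_imp_elim; [apply IHderives1|apply IHderives2].
  - apply d_raa, IHderives.
  - apply d_gen. specialize (IHderives (up s')).
    rewrite map_map in *; erewrite map_ext; [exact IHderives|].
    intros B; symmetry; apply subst_up_shift.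
  - rewrite subst_inst; apply d_inst, IHderives.
  - apply d_refl.
  - rewrite subst_inst; eapply d_leibniz; [apply IHderives1|].
    rewrite <- subst_inst; apply IHderives2.
Qed.

Lemma all_open A : proves PA (All A) -> proves PA A.
Proof.
  (* Instantiating with [Var 0] lowers the other free variables by one, so they are raised first. *)
  intros H; apply (derives_subst _ _) with (s := fun i => Var (S i)) in H.
  apply d_inst with (t := Var 0) in H; unfold inst in H; rewrite subst_comp in H.
  rewrite subst_id in H; [exact H|]. now intros [|i].
Qed.

(** * Derived rules for connectives, quantifiers and equality *)

Section Logic.
Variable T : theory.

Lemma ex_falso G A : derives T G Bot -> derives T G A.
Proof. intros; now apply d_raa, weaken_cons. Qed.

Lemma imp_trans G A B C :
  derives T G (Imp A B) -> derives T G (Imp B C) -> derives T G (Imp A C).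
Proof.
  intros HAB HBC; apply d_imp_intro.
  eapply d_imp_elim; [apply weaken_cons, HBC|].
  eapply d_imp_elim; [apply weaken_cons, HAB|]. apply d_hyp, in_eq.
Qed.

Lemma imp_const G A B : derives T G B -> derives T G (Imp A B).
Proof. intros; now apply d_imp_intro, weaken_cons. Qed.

Lemma contrapositive G A B : derives T G (Imp A B) -> derives T G (Imp (Not B) (Not A)).
Proof.
  intros H; apply d_imp_intro, d_imp_intro.
  eapply d_imp_elim; [apply d_hyp; right; apply in_eq|].
  eapply d_imp_elim; [do 2 apply weaken_cons; exact H|]. apply d_hyp, in_eq.
Qed.

Lemma contrapositive_inv G A B :
  derives T G (Imp (Not B) (Not A)) -> derives T G (Imp A B).
Proof.
  intros H; apply d_imp_intro, d_raa.
  eapply d_imp_elim; [|apply d_hyp; right; apply in_eq].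
  eapply d_imp_elim; [do 2 apply weaken_cons; exact H|]. apply d_hyp, in_eq.
Qed.

Lemma and_elim_l G A B : derives T G (And A B) -> derives T G A.
Proof.
  intros H; apply d_raa; eapply d_imp_elim; [apply weaken_cons, H|].
  apply d_imp_intro, ex_falso; eapply d_imp_elim; [apply d_hyp; right; apply in_eq|].
  apply d_hyp, in_eq.
Qed.

Lemma and_elim_r G A B : derives T G (And A B) -> derives T G B.
Proof.
  intros H; apply d_raa; eapply d_imp_elim; [apply weaken_cons, H|].
  apply imp_const, d_hyp, in_eq.
Qed.

Lemma ex_intro G A t : derives T G (inst A t) -> derives T G (Ex A).
Proof.
  intros H; apply d_imp_intro; eapply d_imp_elim; [|apply weaken_cons, H].
  apply (d_inst T _ (Not A)), d_hyp, in_eq.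
Qed.

Lemma ex_elim G A B :
  derives T G (Ex A) -> derives T (A :: map shift G) (shift B) -> derives T G B.
Proof.
  intros HE HB; apply d_raa; eapply d_imp_elim; [apply weaken_cons, HE|].
  apply d_gen, d_imp_intro. eapply d_imp_elim.
  - apply d_hyp; right; left; reflexivity.
  - eapply weakening; [exact HB|]. simpl; intros C [<-|HC]; simpl; auto.
Qed.

Lemma eq_congr G c s t : derives T G (Eq s t) ->
  derives T G (Eq (tsubst (scons s Var) c) (tsubst (scons t Var) c)).
Proof.
  intros H.
  (* The shifted left side stays fixed while the hole [Var 0] of [c] passes from [s] to [t]. *)
  pose proof (d_leibniz T G (Eq (tshift (tsubst (scons s Var) c)) c) s t H) as K.
  unfold inst in K; cbn [subst] in K; rewrite !tsubst_inst_tshift in K.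
  apply K, d_refl.
Qed.

Lemma eq_trans G r s t :
  derives T G (Eq r s) -> derives T G (Eq s t) -> derives T G (Eq r t).
Proof.
  intros H1 H2.
  pose proof (d_leibniz T G (Eq (tshift r) (Var 0)) s t H2) as K.
  unfold inst in K; cbn in K; rewrite !tsubst_inst_tshift in K. auto.
Qed.

Lemma eq_sym G s t : derives T G (Eq s t) -> derives T G (Eq t s).
Proof.
  intros H.
  pose proof (d_leibniz T G (Eq (Var 0) (tshift s)) s t H) as K.
  unfold inst in K; cbn in K; rewrite !tsubst_inst_tshift in K.
  apply K, d_refl.
Qed.

Lemma eq_succ G s t : derives T G (Eq s t) -> derives T G (Eq (Succ s) (Succ t)).
Proof. apply (eq_congr G (Succ (Var 0))). Qed.

Lemma eq_add G s s' t t' : derives T G (Eq s s') -> derives T G (Eq t t') ->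
  derives T G (Eq (Add s t) (Add s' t')).
Proof.
  intros H1 H2; apply (eq_trans G _ (Add s' t)).
  - apply (eq_congr G (Add (Var 0) (tshift t))) in H1; cbn in H1.
    now rewrite !tsubst_inst_tshift in H1.
  - apply (eq_congr G (Add (tshift s') (Var 0))) in H2; cbn in H2.
    now rewrite !tsubst_inst_tshift in H2.
Qed.

Lemma eq_mul G s s' t t' : derives T G (Eq s s') -> derives T G (Eq t t') ->
  derives T G (Eq (Mul s t) (Mul s' t')).
Proof.
  intros H1 H2; apply (eq_trans G _ (Mul s' t)).
  - apply (eq_congr G (Mul (Var 0) (tshift t))) in H1; cbn in H1.
    now rewrite !tsubst_inst_tshift in H1.
  - apply (eq_congr G (Mul (tshift s') (Var 0))) in H2; cbn in H2.
    now rewrite !tsubst_inst_tshift in H2.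
Qed.

Lemma le_eq G s t t' :
  derives T G (Eq t t') -> derives T G (Le s t) -> derives T G (Le s t').
Proof.
  intros H.
  pose proof (d_leibniz T G (Le (tshift s) (Var 0)) t t' H) as K.
  unfold inst in K; rewrite !subst_Le in K; cbn [tsubst scons] in K.
  now rewrite !tsubst_inst_tshift in K.
Qed.

End Logic.

(** * Arithmetic of numerals inside PA *)

Lemma inst_all_all T G A s t :
  derives T G (All (All A)) ->
  derives T G (subst (scons t (scons s Var)) A).
Proof.
  intros H; apply d_inst with (t := s) in H; cbn in H.
  apply d_inst with (t := t) in H; unfold inst in H; rewrite subst_comp in H.
  erewrite subst_ext; [exact H|]. intros [|[|i]]; [reflexivity| |reflexivity].
  cbn; now rewrite tsubst_inst_tshift.
Qed.

Lemma succ_nonzero G t : derives PA G (Eq (Succ t) Zero) -> derives PA G Bot.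
Proof.
  intros H; eapply d_imp_elim; [|exact H].
  apply (d_inst PA G (Not (Eq (Succ (Var 0)) Zero)) t), d_ax; constructor.
Qed.

Lemma succ_inj G s t : derives PA G (Eq (Succ s) (Succ t)) -> derives PA G (Eq s t).
Proof.
  intros H; eapply d_imp_elim; [|exact H].
  refine (inst_all_all PA G _ s t (d_ax _ _ _ pa_succ_inj)).
Qed.

Lemma add_zero G t : derives PA G (Eq (Add t Zero) t).
Proof. exact (d_inst PA G _ t (d_ax _ _ _ pa_add_zero)). Qed.

Lemma add_succ G s t : derives PA G (Eq (Add s (Succ t)) (Succ (Add s t))).
Proof. exact (inst_all_all PA G _ s t (d_ax _ _ _ pa_add_succ)). Qed.

Lemma mul_zero G t : derives PA G (Eq (Mul t Zero) Zero).
Proof. exact (d_inst PA G _ t (d_ax _ _ _ pa_mul_zero)). Qed.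

Lemma mul_succ G s t : derives PA G (Eq (Mul s (Succ t)) (Add (Mul s t) s)).
Proof. exact (inst_all_all PA G _ s t (d_ax _ _ _ pa_mul_succ)). Qed.

Lemma numeral_add G m n :
  derives PA G (Eq (Add (numeral m) (numeral n)) (numeral (m + n))).
Proof.
  induction n as [|n IH].
  - rewrite Nat.add_0_r; apply add_zero.
  - rewrite Nat.add_succ_r; eapply eq_trans; [apply add_succ|]. now apply eq_succ.
Qed.

Lemma numeral_mul G m n :
  derives PA G (Eq (Mul (numeral m) (numeral n)) (numeral (m * n))).
Proof.
  induction n as [|n IH].
  - rewrite Nat.mul_0_r; apply mul_zero.
  - rewrite Nat.mul_succ_r; eapply eq_trans; [apply mul_succ|].
    eapply eq_trans; [|apply numeral_add]. apply eq_add; [exact IH|apply d_refl].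
Qed.

Lemma numeral_neq G m : forall n, m <> n ->
  derives PA G (Eq (numeral m) (numeral n)) -> derives PA G Bot.
Proof.
  induction m as [|m IH]; intros [|n] Hmn H; simpl in H.
  - congruence.
  - eapply succ_nonzero, eq_sym, H.
  - eapply succ_nonzero, H.
  - apply (IH n); [congruence|]. now apply succ_inj.
Qed.

(** [Le] puts the witness on the left of the sum, so the recursion of addition on its right argument
    exposes the successor at once. *)
Lemma le_succ_inv G s t : derives PA G (Le (Succ s) (Succ t)) -> derives PA G (Le s t).
Proof.
  intros H; eapply ex_elim; [exact H|].
  unfold shift; rewrite subst_Le.
  apply ex_intro with (t := Var 0); unfold inst; cbn [subst tsubst scons].
  rewrite !tsubst_inst_tshift.
  apply succ_inj; eapply eq_trans; [apply eq_sym, add_succ|]. apply d_hyp, in_eq.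
Qed.

Lemma le_succ_zero G s : derives PA G (Le (Succ s) Zero) -> derives PA G Bot.
Proof.
  intros H; eapply ex_elim; [exact H|].
  eapply succ_nonzero, eq_trans; [apply eq_sym, add_succ|]. apply d_hyp, in_eq.
Qed.

Lemma numeral_le G m n : m <= n -> derives PA G (Le (numeral m) (numeral n)).
Proof.
  intros H; apply ex_intro with (t := numeral (n - m)).
  unfold inst; cbn [subst tsubst scons]; rewrite !tsubst_inst_tshift.
  replace n with (n - m + m) at 2 by lia. apply numeral_add.
Qed.

(** Reduces a bounded quantifier to finitely many numeral instances. Each step lowers the bound by
    one and passes from [B] to its successor instance, hence the induction over all [B]. *)
Lemma bounded_cases N : forall B,
  (forall n, n <= N -> proves PA (inst B (numeral n))) ->
  proves PA (Imp (Le (Var 0) (numeral N)) B).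
Proof.
  induction N as [|N IH]; intros B HB; apply all_open;
    (* the induction axiom serves only to split into the cases [0] and [Succ x] *)
    (eapply d_imp_elim; [eapply d_imp_elim; [apply d_ax, pa_induction|]|];
     [apply (imp_const PA), (HB 0); lia|]);
    apply d_gen, d_imp_intro, weaken_cons;
    cbn [subst]; rewrite subst_Le; cbn [tsubst scons]; rewrite tsubst_numeral.
  - apply d_imp_intro, ex_falso; eapply le_succ_zero, d_hyp, in_eq.
  - apply d_imp_intro; eapply d_imp_elim; [|eapply le_succ_inv, d_hyp, in_eq].
    apply weaken_closed, IH; intros n Hn.
    specialize (HB (S n) ltac:(lia)).
    unfold inst in *; rewrite subst_comp; erewrite subst_ext; [exact HB|].
    now intros [|i].
Qed.

(** * Provability of true and refutability of false arithmetical formulas *)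

Definition num (e : nat -> nat) : nat -> term := fun i => numeral (e i).

Lemma tsubst_num G e t :
  derives PA G (Eq (tsubst (num e) t) (numeral (teval e t))).
Proof.
  induction t; simpl.
  - apply d_refl.
  - apply d_refl.
  - now apply eq_succ.
  - eapply eq_trans; [apply eq_add; eassumption|apply numeral_add].
  - eapply eq_trans; [apply eq_mul; eassumption|apply numeral_mul].
Qed.

Lemma inst_num e A n : inst (subst (up (num e)) A) (numeral n) = subst (num (scons n e)) A.
Proof.
  unfold inst; rewrite subst_comp; apply subst_ext; intros [|i]; [reflexivity|].
  apply tsubst_inst_tshift.
Qed.

(** Truth and falsity are treated together because the premise of an implication has opposite
    polarity. *)
Lemma delta0_complete A : Delta0 A -> forall e,
  (sat e A -> proves PA (subst (num e) A)) /\
  (~ sat e A -> proves PA (Not (subst (num e) A))).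
Proof.
  intros H; induction H as [|s t|A B _ IHA _ IHB|t A _ IHA]; intros e; split; intros He.
  - destruct He.
  - apply d_imp_intro, d_hyp, in_eq.
  - simpl in *; eapply eq_trans; [apply tsubst_num|].
    rewrite He; apply eq_sym, tsubst_num.
  - apply d_imp_intro; simpl in *; apply (numeral_neq _ _ _ He).
    eapply eq_trans; [apply eq_sym, tsubst_num|].
    eapply eq_trans; [apply d_hyp, in_eq|apply tsubst_num].
  - destruct (classic (sat e A)) as [HA|HA].
    + apply (imp_const PA), IHB, He, HA.
    + apply d_imp_intro, ex_falso.
      eapply d_imp_elim; [apply weaken_closed, IHA, HA|apply d_hyp, in_eq].
  - assert (HA : sat e A) by (apply NNPP; intros K; apply He; intros K'; now destruct K).
    assert (HB : ~ sat e B) by (intros K; apply He; intros _; exact K).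
    apply d_imp_intro; eapply d_imp_elim; [apply weaken_closed, IHB, HB|].
    eapply d_imp_elim; [apply d_hyp, in_eq|apply weaken_closed, IHA, HA].
  - apply d_gen; cbn [map subst]; rewrite subst_Le.
    replace (tsubst (up (num e)) (tshift t)) with (tsubst (num e) t).
    (* Numerals are closed, so the shift under the binder does not alter the substituted bound. *)
    2: { unfold tshift; rewrite tsubst_comp; apply tsubst_ext; intros i.
         symmetry; apply tsubst_numeral. }
    apply d_imp_intro; eapply d_imp_elim.
    (* The bound [t] is traded for the numeral of its value, which leaves finitely many cases. *)
    + apply weaken_closed, (bounded_cases (teval e t)); intros n Hn.
      rewrite inst_num; apply IHA, (He n), sat_Le; cbn; now rewrite teval_tshift.
    + eapply le_eq; [apply tsubst_num|]. apply d_hyp, in_eq.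
  - apply not_all_ex_not in He as [n Hn].
    assert (Hle : n <= teval e t /\ ~ sat (scons n e) A).
    { simpl in Hn; apply imply_to_and in Hn as [H1 H2].
      apply (sat_Le (scons n e) (Var 0) (tshift t)) in H1.
      rewrite teval_tshift in H1; auto. }
    destruct Hle as [Hle HA].
    apply d_imp_intro; eapply d_imp_elim; [apply weaken_closed, IHA, HA|].
    assert (K : derives PA [subst (num e) (All (Imp (Le (Var 0) (tshift t)) A))]
                  (subst (num (scons n e)) (Imp (Le (Var 0) (tshift t)) A)))
      by (rewrite <- inst_num; apply d_inst, d_hyp, in_eq).
    eapply d_imp_elim; [exact K|].
    change (derives PA [subst (num e) (All (Imp (Le (Var 0) (tshift t)) A))]
              (subst (num (scons n e)) (Le (Var 0) (tshift t)))).
    rewrite (subst_Le (num (scons n e))).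
    replace (tsubst (num (scons n e)) (tshift t)) with (tsubst (num e) t)
      by (unfold tshift; now rewrite tsubst_comp).
    eapply le_eq; [apply eq_sym, tsubst_num|]. now apply numeral_le.
Qed.

Lemma sigma1_complete A : Sigma1 A -> forall e,
  sat e A -> proves PA (subst (num e) A).
Proof.
  intros H; induction H as [A H|A _ IH]; intros e He.
  - now apply delta0_complete.
  - apply sat_Ex in He as [n Hn].
    apply (ex_intro PA [] (subst (up (num e)) A) (numeral n)).
    rewrite inst_num; now apply IH.
Qed.

Lemma pi1_refutable A : Pi1 A -> forall e,
  ~ sat e A -> proves PA (Not (subst (num e) A)).
Proof.
  intros H; induction H as [A H|A _ IH]; intros e He.
  - now apply delta0_complete.
  - apply not_all_ex_not in He as [n Hn].
    apply d_imp_intro; eapply d_imp_elim; [apply weaken_closed, (IH _ Hn)|].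
    rewrite <- inst_num; apply d_inst, d_hyp, in_eq.
Qed.

(** The [Sigma1] form yields proofs of true instances, the [Pi1] form refutations of false ones;
    soundness carries truth values across the two provable equivalences. *)
Lemma PA_Delta1_decided A e : PA_Delta1 A ->
  (sat e A -> proves PA (subst (num e) A)) /\
  (~ sat e A -> proves PA (Not (subst (num e) A))).
Proof.
  intros [(B & HB & EB) (C & HC & EC)]; split; intros He.
  - pose proof (derives_subst _ _ EB (num e)) as K; apply PA_sound in EB.
    eapply d_imp_elim; [eapply and_elim_r, K|].
    apply sigma1_complete; [exact HB|]. apply (sat_Iff e A B); auto.
  - pose proof (derives_subst _ _ EC (num e)) as K; apply PA_sound in EC.
    eapply d_imp_elim; [eapply contrapositive, and_elim_l, K|].
    apply pi1_refutable; [exact HC|]. intros H; apply He, (sat_Iff e A C); auto.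
Qed.

(** [C] is a sentence, so [d_gen] leaves it unchanged in the context. *)
Lemma derives_PA_plus T C G A :
  sentence C -> (forall B, T B -> proves PA (Imp C B)) ->
  derives (PA_plus T) G A -> derives PA (C :: G) A.
Proof.
  intros HC HT H; induction H.
  - destruct H as [H|H]; [now apply d_ax|].
    eapply d_imp_elim; [apply weaken_closed, HT, H|apply d_hyp, in_eq].
  - now apply d_hyp, in_cons.
  - apply d_imp_intro; eapply weakening; [exact IHderives|]. intros D; simpl; tauto.
  - eapply d_imp_elim; eassumption.
  - apply d_raa; eapply weakening; [exact IHderives|]. intros D; simpl; tauto.
  - apply d_gen; simpl; unfold shift at 1; rewrite subst_sentence; assumption.
  - now apply d_inst.
  - apply d_refl.
  - eapply d_leibniz; eassumption.
Qed.

Lemma PA_proves_PA_plus T A : proves PA A -> proves (PA_plus T) A.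
Proof. apply derives_cut; intros B HB; apply d_ax; now left. Qed.

(** * The proof predicate and its provability operator *)

Section Provability.
Variable prf : form.
Hypothesis Hproof : proof_predicate prf.
Hypothesis Hlogic : obeys_provability_logic prf.

Local Notation Box := (Provable prf).

Lemma sentence_Prf k A : sentence (Prf prf k A).
Proof.
  apply (closed_subst _ 2); [apply Hproof|].
  intros [|[|i]] Hi; [apply tclosed_numeral..|lia].
Qed.

Lemma sentence_Provable A : sentence (Box A).
Proof.
  cbn; intuition. apply (closed_subst _ 2); [apply Hproof|].
  intros [|[|i]] Hi; [simpl; lia|apply tclosed_numeral|lia].
Qed.

(** The value 0 beyond [Var 1] is a mere default, since [prf] has at most two free variables. *)
Let env (k : nat) (A : form) : nat -> nat := scons k (scons (code A) (fun _ => 0)).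

Lemma Prf_num k A : Prf prf k A = subst (num (env k A)) prf.
Proof.
  apply (subst_closed _ 2); [apply Hproof|].
  intros [|[|i]] Hi; [reflexivity..|lia].
Qed.

Lemma sat_Prf e k A : sat e (Prf prf k A) <-> sat (env k A) prf.
Proof.
  rewrite Prf_num, sat_subst; apply sat_ext; intros i; apply teval_numeral.
Qed.

Lemma holds_Prf e k A : sat e (Prf prf k A) <-> holds (Prf prf k A).
Proof.
  split; [|intros H; apply H].
  intros H e'; rewrite sat_Prf in *; exact H.
Qed.

Lemma Prf_decided k A :
  (holds (Prf prf k A) -> proves PA (Prf prf k A)) /\
  (~ holds (Prf prf k A) -> proves PA (Not (Prf prf k A))).
Proof.
  assert (E : holds (Prf prf k A) <-> sat (env k A) prf)
    by (rewrite <- (holds_Prf (fun _ => 0)); apply sat_Prf).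
  rewrite E, Prf_num; apply PA_Delta1_decided, Hproof.
Qed.

Lemma proves_iff_Prf A : proves PA A <-> exists k, holds (Prf prf k A).
Proof. apply Hproof. Qed.

Lemma inst_Provable_body k A :
  inst (subst (scons (Var 0) (scons (numeral (code A)) (fun i => Var (S i)))) prf)
    (numeral k) = Prf prf k A.
Proof.
  unfold inst, Prf; rewrite subst_comp; apply subst_ext.
  intros [|[|i]]; [reflexivity|apply tsubst_numeral|reflexivity].
Qed.

(** Together with [PA_sound] this lets a box be removed from a theorem of PA. *)
Lemma sat_Provable e A : sat e (Box A) <-> proves PA A.
Proof.
  unfold Provable; rewrite sat_Ex, proves_iff_Prf.
  assert (E : forall k, holds (Prf prf k A) <-> sat (scons k e)
      (subst (scons (Var 0) (scons (numeral (code A)) (fun i => Var (S i)))) prf)).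
  { intros k; rewrite <- (holds_Prf e), <- inst_Provable_body, sat_inst.
    now rewrite teval_numeral. }
  split; intros [k Hk]; exists k; now apply E.
Qed.

Lemma necessitation A : proves PA A -> proves PA (Box A).
Proof.
  intros H; apply proves_iff_Prf in H as [k Hk].
  apply (ex_intro _ _ _ (numeral k)); rewrite inst_Provable_body.
  now apply Prf_decided.
Qed.

Lemma Provable_mono A B : sentence A -> sentence B ->
  proves PA (Imp A B) -> proves PA (Imp (Box A) (Box B)).
Proof.
  intros HA HB H; eapply d_imp_elim; [apply (Hlogic A B HA HB)|].
  now apply necessitation.
Qed.

(** * Iterated boxes and the hierarchy of consistency statements *)

Fixpoint boxes (k : nat) (A : form) : form :=
  match k with 0 => A | S j => Box (boxes j A) end.

Lemma sentence_boxes k A : sentence A -> sentence (boxes k A).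
Proof. destruct k; simpl; auto using sentence_Provable. Qed.

Lemma boxes_mono k A B : sentence A -> sentence B ->
  proves PA (Imp A B) -> proves PA (Imp (boxes k A) (boxes k B)).
Proof.
  intros HA HB H; induction k; simpl; auto using Provable_mono, sentence_boxes.
Qed.

Lemma boxes_add k l A : boxes (k + l) A = boxes k (boxes l A).
Proof. induction k; simpl; congruence. Qed.

Lemma boxes_reflect k A : proves PA (boxes k A) -> proves PA A.
Proof.
  induction k; simpl; auto; intros H.
  apply IHk, (sat_Provable (fun _ => 0)), (PA_sound _ H).
Qed.

(** Iterates the axiom [Box F -> Box (Box F)], using monotonicity of the box. *)
Lemma Provable_boxes k A : sentence A -> proves PA (Imp (Box A) (boxes (S k) A)).
Proof.
  intros HA; induction k; [apply d_imp_intro, d_hyp, in_eq|].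
  eapply imp_trans; [apply (Hlogic A A HA HA)|].
  apply Provable_mono; auto using sentence_Provable.
Qed.

Lemma PA_consistent : ~ proves PA Bot.
Proof. intros H; exact (PA_sound _ H (fun _ => 0)). Qed.

(** [Con 0] is provable outright, in line with [u:P -> P]; [Con 1] is the consistency of PA. *)
Definition Con (k : nat) : form := Not (boxes k Bot).

Lemma sentence_Con k : sentence (Con k).
Proof. split; [now apply sentence_boxes|exact Logic.I]. Qed.

(** Ex falso gives [Bot -> Box^(l-k) Bot]; [k] further boxes are put on both sides before
    contraposing. *)
Lemma Con_le k l : k <= l -> proves PA (Imp (Con l) (Con k)).
Proof.
  intros H; apply contrapositive.
  replace l with (k + (l - k)) by lia; rewrite boxes_add.
  apply boxes_mono; [exact Logic.I|now apply sentence_boxes|].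
  apply d_imp_intro, ex_falso, d_hyp, in_eq.
Qed.

(** Löb's theorem turns a proof of [Con k -> Con (S k)] into one of [boxes k Bot]. *)
Lemma Con_strict k : ~ proves PA (Imp (Con k) (Con (S k))).
Proof.
  intros H; apply contrapositive_inv in H.
  assert (HS : sentence (boxes k Bot)) by now apply sentence_boxes.
  apply PA_consistent, (boxes_reflect k), (sat_Provable (fun _ => 0)).
  apply PA_sound; eapply d_imp_elim; [apply (Hlogic _ _ HS HS)|].
  now apply necessitation.
Qed.

(** * Generators containing a proof variable *)

(** Both modalities express actual provability in the standard model, so soundness strips them one
    at a time. This is a closure property of PA, not an implication proved in PA. *)
Lemma interp_reflect I Qs F :
  proves PA (interp prf I (fold_right apply_modality F Qs)) -> proves PA (interp prf I F).
Proof.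
  induction Qs as [|[|v] Qs IH]; simpl; auto; intros H; apply IH.
  - apply (sat_Provable (fun _ => 0)), (PA_sound _ H).
  - apply proves_iff_Prf; eexists; apply (PA_sound _ H).
Qed.

Lemma interp_boxes I k F :
  interp prf I (fold_right apply_modality F (repeat MBox k)) = boxes k (interp prf I F).
Proof. induction k; simpl; congruence. Qed.

Lemma interp_reflection_boxes I k p :
  interp prf I (reflection (repeat MBox k) p) =
  Imp (boxes k (letter_val I p)) (letter_val I p).
Proof. exact (f_equal (fun A => Imp A _) (interp_boxes I k (Letter p))). Qed.

(** Giving all letters the same value makes the letter of a generator immaterial. *)
Definition const_interp (A : form) (HA : sentence A) : interpretation :=
  {| letter_val := fun _ => A; letter_sentence := fun _ => HA; proofvar_val := fun _ => 0 |}.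

(** Over PA the whole scheme amounts to the single sentence [C], so schemes can be compared by an
    implication between sentences. *)
Definition axiomatized (C : form) (G : pform) : Prop :=
  sentence C /\
  (forall A, interps prf G A -> proves PA (Imp C A)) /\
  proves (PA_plus (interps prf G)) C.

(** From left to right this is the deduction theorem [derives_PA_plus], applied to a proof of [D]
    from the instances of [G]. *)
Lemma preceq_axiomatized C D G H : axiomatized C G -> axiomatized D H ->
  preceq prf H G <-> proves PA (Imp C D).
Proof.
  intros (HC & CG & GC) (HD & DH & HD'); split.
  - intros K; apply d_imp_intro, (derives_PA_plus (interps prf G)); auto.
    refine (derives_cut _ _ _ _ _ HD'); intros B [HB|HB]; [|now apply K].
    now apply PA_proves_PA_plus, d_ax.
  - intros K A HA; eapply d_imp_elim; [apply PA_proves_PA_plus, DH, HA|].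
    eapply d_imp_elim; [apply PA_proves_PA_plus, K|exact GC].
Qed.

Lemma axiomatized_Con k v Qs p :
  axiomatized (Con k) (reflection (repeat MBox k ++ MProof v :: Qs) p).
Proof.
  split; [apply sentence_Con|split].
  - intros A [I ->]; unfold reflection; rewrite fold_right_app; simpl.
    rewrite interp_boxes; simpl.
    set (F := interp prf I _); set (n := proofvar_val I v).
    destruct (classic (holds (Prf prf n F))) as [H|H].
    + do 2 apply (imp_const PA).
      (* The number [n] proves [F], and stripping the inner modalities [Qs] leaves a proof of the
         letter's value. *)
      apply (interp_reflect I Qs (Letter p)), proves_iff_Prf; now exists n.
    + apply Prf_decided in H.
      apply (boxes_mono k) in H; [|apply sentence_Prf|exact Logic.I].
      apply d_imp_intro, d_imp_intro, ex_falso.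
      eapply d_imp_elim; [apply d_hyp; right; apply in_eq|].
      eapply d_imp_elim; [apply weaken_closed, H|apply d_hyp, in_eq].
  (* With all letters read as [Bot], no number proves [F], since otherwise PA would prove [Bot]. The
     instance reads [Box^k Prf -> Bot], and [Box^k Bot] implies its premise. *)
  - set (I := const_interp Bot Logic.I).
    set (F := interp prf I (fold_right apply_modality (Letter p) Qs)).
    assert (H : ~ holds (Prf prf (proofvar_val I v) F)).
    { intros H; apply PA_consistent, (interp_reflect I Qs (Letter p)).
      apply proves_iff_Prf; eexists; exact H. }
    eapply imp_trans; [apply PA_proves_PA_plus, boxes_mono|].
    + exact Logic.I.
    + apply sentence_Prf.
    + apply d_imp_intro, ex_falso, d_hyp, in_eq.
    + apply d_ax; right; exists I; unfold reflection.
      rewrite fold_right_app; simpl; rewrite interp_boxes; reflexivity.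
Qed.

Lemma axiomatized_chain k u P : axiomatized (Con k) (chain k u P).
Proof. apply axiomatized_Con. Qed.

(** * Generators made of boxes alone *)

(** The boxes come off one by one, each by the instance of [Box P -> P] whose letter is the
    remaining [boxes k A]. *)
Lemma chain_top_boxes P k A : sentence A ->
  proves (PA_plus (interps prf (chain_top P))) (Imp (boxes k A) A).
Proof.
  intros HA; induction k; [apply d_imp_intro, d_hyp, in_eq|].
  refine (imp_trans _ _ _ _ _ _ IHk); apply d_ax; right.
  now exists (const_interp _ (sentence_boxes k A HA)).
Qed.

(** One direction prefixes [Box A -> Box^(k+1) A], the other strips boxes. At least one box is
    required: with none the scheme is the trivial [P -> P]. *)
Lemma simeq_chain_top k p P :
  simeq prf (reflection (repeat MBox (S k)) p) (chain_top P).
Proof.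
  split; intros A [I ->].
  - apply (imp_trans _ _ _ (boxes (S k) (letter_val I P))).
    + apply PA_proves_PA_plus, (Provable_boxes k), letter_sentence.
    + apply d_ax; right; exists (const_interp _ (letter_sentence I P)).
      now rewrite interp_reflection_boxes.
  - rewrite interp_reflection_boxes; apply chain_top_boxes, letter_sentence.
Qed.

(** The first proof variable fixes the strength: [axiomatized_Con] depends only on the number of
    boxes before it. *)
Lemma modalities_cases Qs :
  (exists k v Qs', Qs = repeat MBox k ++ MProof v :: Qs') \/ Qs = repeat MBox (length Qs).
Proof.
  induction Qs as [|[|v] Qs [(k & w & Qs' & IH)|IH]].
  - now right.
  - left; exists (S k), w, Qs'; simpl; congruence.
  - right; simpl; congruence.
  - left; now exists 0, v, Qs.
  - left; now exists 0, v, Qs.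
Qed.

(** * The ordering of reflection principles *)

Lemma preceq_refl G : preceq prf G G.
Proof. intros A HA; apply d_ax; now right. Qed.

Lemma preceq_trans G H K : preceq prf G H -> preceq prf H K -> preceq prf G K.
Proof.
  intros GH HK A HA; refine (derives_cut _ _ _ _ _ (GH A HA)).
  intros B [HB|HB]; [apply d_ax; now left|now apply HK].
Qed.

Lemma preceq_simeq G G' H H' :
  simeq prf G G' -> simeq prf H H' -> preceq prf G' H' -> preceq prf G H.
Proof.
  intros [_ K] [L _] M; eapply preceq_trans; [exact K|].
  eapply preceq_trans; [exact M|exact L].
Qed.

Lemma chain_le k l u P : k <= l -> preceq prf (chain k u P) (chain l u P).
Proof.
  intros H; apply (preceq_axiomatized (Con l) (Con k)); auto using axiomatized_chain, Con_le.
Qed.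

Lemma chain_le_top k u P : preceq prf (chain k u P) (chain_top P).
Proof.
  intros A HA; eapply d_imp_elim.
  - apply PA_proves_PA_plus, (axiomatized_chain k u P), HA.
  (* [Con k] unfolds to [boxes k Bot -> Bot], the case [A := Bot]. *)
  - apply chain_top_boxes; exact Logic.I.
Qed.

Lemma chain_strict k u P : ~ preceq prf (chain (S k) u P) (chain k u P).
Proof.
  intros H; apply (Con_strict k).
  apply (preceq_axiomatized _ _ _ _ (axiomatized_chain k u P) (axiomatized_chain (S k) u P)), H.
Qed.

Lemma generator_classification G u P : generator G ->
  (exists k, simeq prf G (chain k u P)) \/ simeq prf G (chain_top P).
Proof.
  intros (Qs & p & HQ & _ & ->).
  destruct (modalities_cases Qs) as [(k & v & Qs' & ->)|HE].
  - left; exists k; pose proof (axiomatized_Con k v Qs' p) as E.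
    (* Both sides are axiomatized by the same [Con k]. *)
    split; (eapply preceq_axiomatized; [..|apply (Con_le k k), le_n]);
      auto using axiomatized_chain.
  (* The list is nonempty, so its length has the form [S k]. *)
  - right; destruct Qs; [congruence|]. rewrite HE; apply simeq_chain_top.
Qed.

(** Both generators are moved to their places in the chain, where comparison is that of [k] and [l]
    or with the top. *)
Lemma generator_total G H (u P : nat) : generator G -> generator H ->
  preceq prf G H \/ preceq prf H G.
Proof.
  intros HG HH.
  destruct (generator_classification G u P HG) as [[k EG]|EG],
    (generator_classification H u P HH) as [[l EH]|EH].
  - destruct (Nat.le_ge_cases k l); [left|right];
      eapply preceq_simeq; eauto using chain_le.
  - left; eapply preceq_simeq; eauto using chain_le_top.
  - right; eapply preceq_simeq; eauto using chain_le_top.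
  - left; eapply preceq_simeq; eauto using preceq_refl.
Qed.

End Provability.

Theorem theorem5 (prf : form)
    (Hnormal : normal_proof_predicate prf)
    (Hlogic : obeys_provability_logic prf)
    (u P : nat) :
  ((forall G, generator G -> preceq prf G G) /\
   (forall G H K, generator G -> generator H -> generator K ->
      preceq prf G H -> preceq prf H K -> preceq prf G K) /\
   (forall G H, generator G -> generator H ->
      preceq prf G H \/ preceq prf H G)) /\
  (forall G, generator G ->
     (exists k, simeq prf G (chain k u P)) \/ simeq prf G (chain_top P)) /\
  (forall k,
     prec prf (chain k u P) (chain (S k) u P) /\
     prec prf (chain k u P) (chain_top P)).
Proof.
  destruct Hnormal as [Hproof _].
  split; [split; [|split]|split].
  - intros G _; apply preceq_refl.
  - intros G H K _ _ _; apply preceq_trans.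
  - intros G H HG HH; now apply (generator_total prf Hproof Hlogic G H u P).
  - intros G HG; now apply generator_classification.
  - intros k; split; split.
    + apply chain_le; auto.
    + intros [H _]; now apply chain_strict in H.
    + now apply chain_le_top.
    (* If the top lay below the principle at [k], so would the one at [S k], against strictness. *)
    + intros [H _]; apply (chain_strict prf Hproof Hlogic k u P).
      eapply preceq_trans; [now apply chain_le_top|exact H].
Qed.
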